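(* Let $p\neq 3$ be a prime and $\mathbf{k}$ a field of characteristic $p$. Define $$\widetilde{\mathcal{I}}_p=\begin{cases}\mathcal{I}_p+\tfrac13 t^p(\alpha_1^p-\alpha_1-\alpha_2^p+\alpha_2), & p\geq5,\\ \mathcal{I}_2+(1+t^2)(\alpha_1^2+\alpha_1+\alpha_2^2+\alpha_2), & p=2.\end{cases}$$ Then $\widetilde{\mathcal{I}}_p$ is invariant under the extended affine Weyl group action: $w(\widetilde{\mathcal{I}}_p)=\widetilde{\mathcal{I}}_p$ for every $w$ in the group $\widetilde W(A_2^{(1)})$ of field automorphisms generated by $s_0,s_1,s_2,\pi$.
   Context: On $\mathbf{k}(f,g,\alpha_1,\alpha_2,t)$ let $s_0,s_1,s_2,\pi$ be the $\mathbf{k}$-linear field automorphisms fixing $t$ and acting by: $s_0:\ \alpha_1\mapsto 1-\alpha_2,\ \alpha_2\mapsto1-\alpha_1,\ f\mapsto f+\frac{\alpha_1+\alpha_2-1}{f-g+t},\ g\mapsto g+\frac{\alpha_1+\alpha_2-1}{f-g+t}$; $s_1:\ \alpha_1\mapsto-\alpha_1,\ \alpha_2\mapsto\alpha_1+\alpha_2,\ f\mapsto f,\ g\mapsto g-\frac{\alpha_1}{f}$; $s_2:\ \alpha_1\mapsto\alpha_1+\alpha_2,\ \alpha_2\mapsto-\alpha_2,\ f\mapsto f+\frac{\alpha_2}{g},\ g\mapsto g$; $\pi:\ \alpha_1\mapsto\alpha_2,\ \alpha_2\mapsto1-\alpha_1-\alpha_2,\ f\mapsto -g,\ g\mapsto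 f-g+t$. Define the $2\times2$ matrix polynomial in $z$ $$A(z)=\begin{bmatrix}w&0\\0&1\end{bmatrix}\begin{bmatrix}1&0\\ f-tfg-tz&1\end{bmatrix}\begin{bmatrix}g&1\\ z+\alpha_2&0\end{bmatrix}\begin{bmatrix}-f&1\\ z&0\end{bmatrix}\begin{bmatrix}tz-g+tfg&1\\ z-\alpha_1&0\end{bmatrix}\begin{bmatrix}w^{-1}&0\\0&1\end{bmatrix}$$ and $\mathcal{I}_p:=\operatorname{Tr}[A(p-1)A(p-2)\cdots A(1)A(0)]$ computed in characteristic $p$, an element of $\mathbb{F}_p[f,g,\alpha_1,\alpha_2,t]$ independent of $w$, viewed in $\mathbf{k}(f,g,\alpha_1,\alpha_2,t)$. *)

(* Defs.v *)
From HB Require Import structures.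
From mathcomp Require Import all_boot all_order all_algebra.
From mathcomp Require Import generic_quotient fraction.
From mathcomp Require Import mpoly.

Set Implicit Arguments.
Unset Strict Implicit.
Unset Printing Implicit Defensive.

Import Order.TTheory GRing.Theory.
Local Open Scope ring_scope.

Section Painleve.
Variable F : fieldType.

Definition PolR := {mpoly F[5]}.

Definition RatF : fieldType := {fraction PolR}.

Definition var (i : 'I_5) : RatF := tofrac ('X_i : PolR).
Definition vf  : RatF := var (@Ordinal 5 0 isT).
Definition vg  : RatF := var (@Ordinal 5 1 isT).
Definition va1 : RatF := var (@Ordinal 5 2 isT).
Definition va2 : RatF := var (@Ordinal 5 3 isT).
Definition vt  : RatF := var (@Ordinal 5 4 isT).

Definition subst_pol (img : 'I_5 -> RatF) (q : PolR) : RatF :=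
  mmap (fun c : F => tofrac (c%:MP : PolR)) img q.

Definition subst (img : 'I_5 -> RatF) (x : RatF) : RatF :=
  subst_pol img (frac (repr x)).1 / subst_pol img (frac (repr x)).2.

Definition img_of (a b c d e : RatF) (i : 'I_5) : RatF :=
  nth 0 [:: a; b; c; d; e] i.

Definition img_s0 : 'I_5 -> RatF :=
  let q := (va1 + va2 - 1) / (vf - vg + vt) in
  img_of (vf + q) (vg + q) (1 - va2) (1 - va1) vt.
Definition img_s1 : 'I_5 -> RatF :=
  img_of vf (vg - va1 / vf) (- va1) (va1 + va2) vt.
Definition img_s2 : 'I_5 -> RatF :=
  img_of (vf + va2 / vg) vg (va1 + va2) (- va2) vt.
Definition img_pi : 'I_5 -> RatF :=
  img_of (- vg) (vf - vg + vt) va2 (1 - va1 - va2) vt.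

Inductive in_Wext : (RatF -> RatF) -> Prop :=
| Wext_id : in_Wext id
| Wext_s0 : in_Wext (subst img_s0)
| Wext_s1 : in_Wext (subst img_s1)
| Wext_s2 : in_Wext (subst img_s2)
| Wext_pi : in_Wext (subst img_pi)
| Wext_comp u v : in_Wext u -> in_Wext v -> in_Wext (u \o v)
| Wext_inv u v : in_Wext u -> cancel u v -> cancel v u -> in_Wext v.

Definition mx2 (a b c d : RatF) : 'M[RatF]_2 :=
  \matrix_(i < 2, j < 2)
    if i == 0 :> nat then (if j == 0 :> nat then a else b)
    else (if j == 0 :> nat then c else d).

(* A(z) with w = 1 (the trace below is independent of w). *)
Definition Amx (z : RatF) : 'M[RatF]_2 :=
  mx2 1 0 (vf - vt * vf * vg - vt * z) 1 *m
  mx2 vg 1 (z + va2) 0 *m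
  mx2 (- vf) 1 z 0 *m
  mx2 (vt * z - vg + vt * vf * vg) 1 (z - va1) 0.

(* I_p = Tr [A(p-1) A(p-2) ... A(1) A(0)], computed in characteristic p
   (the field k has characteristic p, so the image of F_p in k is used). *)
Definition Ip (p : nat) : RatF :=
  \tr (\prod_(i < p) Amx (p.-1 - i)%:R).

Definition Itilde (p : nat) : RatF :=
  if p == 2 then
    Ip p + (1 + vt ^+ 2) * (va1 ^+ 2 + va1 + va2 ^+ 2 + va2)
  else
    Ip p + 3%:R^-1 * vt ^+ p * (va1 ^+ p - va1 - va2 ^+ p + va2).

End Painleve.

(* Main.v *)
Require Import Defs.
From HB Require Import structures.
From mathcomp Require Import all_boot all_order all_algebra all_fingroup cyclic.
From mathcomp Require Import generic_quotient fraction.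
From mathcomp Require Import mpoly.
From mathcomp Require Import ring zify.

(*
With M(a, x) = [a, 1; x, 0], a lower unitriangular gauge transformation turns
A(z) into L(z) = M(g, z + a2) M(-f, z) M(f - g + t, z - a1), so I_p = T(0) where
T(z) = Tr (L(z + p - 1) ... L(z)).  Each generator permutes the three factors
cyclically or exchanges the parameters x, y of two adjacent ones (the two
orders differ by a gauge), up to a shift of z; hence s0, s1, s2, pi send T(0) to
T(0), T(a1), T(-a2), T(-a2).

It remains to see that T(z) - T(0) = t^p (z^p - z) for odd p, the case p = 2
being a direct computation.  Expand T(z) over closed words v : Z/p -> {0, 1} of
matrix indices.  Rotating a word amounts to z := z + 1, so a rotation orbit of a
nonconstant word contributes sum_j h(z + j) with deg h <= 2p - 2, which does not
depend on z.  The two constant words contribute the products over z + j of the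
diagonal entries of L, which are affine in z with slopes f + t and -f, that is
((f + t)^p + (-f)^p) (z^p - z) = t^p (z^p - z) plus constants.
*)

Set Implicit Arguments.
Unset Strict Implicit.
Unset Printing Implicit Defensive.

Import GRing.Theory.
Local Open Scope ring_scope.

(** * Ordered products of two-by-two matrices and gauge invariance of their traces *)

Section TwoByTwo.
Variable R : comNzRingType.

Definition mat22 (a b c d : R) : 'M[R]_2 :=
  \matrix_(i < 2, j < 2)
    if i == 0 :> nat then (if j == 0 :> nat then a else b)
    else (if j == 0 :> nat then c else d).

Lemma mul_mat22 a b c d a' b' c' d' :
  mat22 a b c d *m mat22 a' b' c' d' =
  mat22 (a * a' + b * c') (a * b' + b * d') (c * a' + d * c') (c * b' + d * d').
Proof.
by apply/matrixP => i j; rewrite !mxE !big_ord_recl big_ord0 !mxE /= addr0;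
  case: ifP => _; case: ifP => _.
Qed.

Lemma mxtrace_mat22 a b c d : \tr (mat22 a b c d) = a + d.
Proof. by rewrite /mxtrace !big_ord_recl big_ord0 !mxE /= addr0. Qed.

Definition mono (n : nat) (X : nat -> 'M[R]_2) : 'M[R]_2 :=
  \prod_(i < n) X (n.-1 - i)%N.

Lemma mono0 X : mono 0 X = 1%:M.
Proof. by rewrite /mono big_ord0. Qed.

Lemma monoS n X : mono n.+1 X = X n *m mono n X.
Proof.
rewrite /mono big_ord_recl /= subn0; congr (_ *m _).
by apply: eq_bigr => i _; rewrite /bump /= add1n; case: n i => [[]//|n] i.
Qed.

Lemma monoSr n X : mono n.+1 X = mono n (fun i => X i.+1) *m X 0%N.
Proof.
elim: n => [|n IH]; first by rewrite monoS !mono0 mulmx1 mul1mx.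
by rewrite monoS IH monoS mulmxA.
Qed.

Lemma eq_mono n X Y : (forall i, (i < n)%N -> X i = Y i) -> mono n X = mono n Y.
Proof.
elim: n => [|n IH] eqXY; first by rewrite !mono0.
by rewrite !monoS eqXY // IH // => i /ltnW; exact: eqXY.
Qed.

(** Regrouping gives X_{n-1} ... X_0 = U_{n-1} Y_{n-2} ... Y_0 V_0; cyclicity of the trace brings
    V_0 = V_n to the front, where it completes Y_{n-1}. *)
Lemma trace_mono_swap n (X Y U V : nat -> 'M[R]_2) :
    (forall i, X i = U i *m V i) -> (forall i, Y i = V i.+1 *m U i) ->
  V n = V 0%N -> \tr (mono n X) = \tr (mono n Y).
Proof.
move=> XE YE; case: n => [|n] Vn; first by rewrite !mono0.
have -> : mono n.+1 X = U n *m mono n Y *m V 0%N.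
  elim: n {Vn} => [|n IH]; first by rewrite monoS !mono0 !mulmx1 XE.
  by rewrite monoS IH monoS XE YE !mulmxA.
by rewrite mxtrace_mulC monoS YE Vn mulmxA.
Qed.

Definition lower (c : R) := mat22 1 0 c 1.

Lemma lowerK c : lower (- c) *m lower c = 1%:M.
Proof.
rewrite mul_mat22; apply/matrixP => i j; rewrite !mxE.
by case: i => [[|[|//]]] ?; case: j => [[|[|//]]] ? /=; ring.
Qed.

Lemma trace_mono_gauge n (X Y : nat -> 'M[R]_2) (q : nat -> R) :
    (forall i, lower (q i.+1) *m X i = Y i *m lower (q i)) -> q n = q 0%N ->
  \tr (mono n X) = \tr (mono n Y).
Proof.
move=> XY qn.
apply: (@trace_mono_swap _ _ _ (fun i => X i *m lower (- q i)) (fun i => lower (q i))).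
- by move=> i; rewrite -mulmxA lowerK mulmx1.
- by move=> i; rewrite mulmxA XY -mulmxA -{1}[q i]opprK lowerK mulmx1.
- by rewrite qn.
Qed.

Definition fac (a x : R) := mat22 a 1 x 0.

Lemma fac_lower a q x : fac (a + q) x = fac a x *m lower q.
Proof. by rewrite mul_mat22; congr mat22; ring. Qed.

(** The exchange behind s0, s1 and s2: with q = (x - y)/a the parameters trade places at the cost of
    a gauge on the left and a shift of b. *)
Lemma fac_refactor a b q x y : a * q = x - y ->
  lower (- q) *m fac a x *m fac (b + q) y = fac a y *m fac b x.
Proof.
move=> aq; rewrite !mul_mat22; have -> : x = a * q + y by rewrite aq; ring.
by congr mat22; ring.
Qed.

(** A(z) with w = 1 over any commutative ring, so that ring morphisms carry it from polynomials to
    fractions. *)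
Definition lax (f g a1 a2 t z : R) : 'M[R]_2 :=
  mat22 1 0 (f - t * f * g - t * z) 1 *m
  mat22 g 1 (z + a2) 0 *m
  mat22 (- f) 1 z 0 *m
  mat22 (t * z - g + t * f * g) 1 (z - a1) 0.

Definition lax3 (f g a1 a2 t z : R) : 'M[R]_2 :=
  fac g (z + a2) *m fac (- f) z *m fac (f - g + t) (z - a1).

Definition trT (p : nat) (f g a1 a2 t z : R) : R :=
  \tr (mono p (fun i => lax3 f g a1 a2 t (z + i%:R))).

Definition trI (p : nat) (f g a1 a2 t : R) : R :=
  \tr (\prod_(i < p) lax f g a1 a2 t (p.-1 - i)%:R).

End TwoByTwo.

(** * Action of the generators on the trace *)

Section Char.
Variables (R : comNzRingType) (p : nat).
Hypothesis charR : p \in [pchar R].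

Lemma trI_trT (f g a1 a2 t : R) : trI p f g a1 a2 t = trT p f g a1 a2 t 0.
Proof.
(* The last factor of A(z) is [fac (f - g + t) (z - a1)] times [lower (q z)] with q(z) = tz + tfg -
   f - t, and q(z + 1) cancels the leading lower factor. In characteristic p, q has period p. *)
apply: (trace_mono_gauge (q := fun i => t * i%:R + t * f * g - f - t)
   (X := fun i => lax f g a1 a2 t i%:R)).
  move=> i; rewrite /lax /lax3 !mul_mat22 -[i.+1]addn1 natrD add0r.
  by congr mat22; ring.
by rewrite pcharf0.
Qed.

Lemma trI_s0 (f g a1 a2 t q : R) : (f - g + t) * q = a1 + a2 - 1 ->
  trI p (f + q) (g + q) (1 - a2) (1 - a1) t = trI p f g a1 a2 t.
Proof.
move=> qE; rewrite !trI_trT /trT.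
(* The parameters to exchange belong to the third factor at z + 1 and the first at z, so the third
   factor is rotated to the front. *)
pose cyc F G A1 A2 (i : nat) := fac (F - G + t) (i.+1%:R - A1) *m (fac G (i%:R + A2) *m fac (- F) i%:R).
have rot F G A1 A2 : \tr (mono p (fun i => lax3 F G A1 A2 t (0 + i%:R))) =
     \tr (mono p (cyc F G A1 A2)).
  apply: (trace_mono_swap (U := fun i => fac G (i%:R + A2) *m fac (- F) i%:R)
            (V := fun i => fac (F - G + t) (i%:R - A1))) => //.
  - by move=> i; rewrite add0r.
  - by rewrite pcharf0.
rewrite !rot.
apply: (@trace_mono_gauge _ _ _ _ (fun=> - q)) => // i; rewrite /cyc.
have -> : - (f + q) = - f + (- q) by ring.
have -> : f + q - (g + q) + t = f - g + t by ring.
rewrite (fac_lower (- f)) !mulmxA; congr (_ *m _); congr (_ *m _).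
by rewrite fac_refactor -?natr1 ?qE; [congr (fac _ _ *m fac _ _)|]; ring.
Qed.

Lemma trI_s1 (f g a1 a2 t q : R) : f * q = a1 ->
  trI p f (g - q) (- a1) (a1 + a2) t = trT p f g a1 a2 t a1.
Proof.
move=> qE; rewrite trI_trT; congr (\tr _); apply: eq_mono => i _.
(* The last two factors exchange parameters; the first one absorbs the gauge, so the matrices agree
   one by one. *)
rewrite /lax3 (fac_lower g) (_ : f - (g - q) + t = f - g + t + q); last by ring.
rewrite -2!(mulmxA (fac g _)) fac_refactor; last by rewrite mulNr qE; ring.
by rewrite mulmxA; congr (fac _ _ *m fac _ _ *m fac _ _); ring.
Qed.

Lemma trI_s2 (f g a1 a2 t q : R) : g * q = a2 ->
  trI p (f + q) g (a1 + a2) (- a2) t = trT p f g a1 a2 t (- a2).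
Proof.
move=> qE; rewrite trI_trT.
apply: (@trace_mono_gauge _ _ _ _ (fun=> q)) => // i.
rewrite /lax3 (_ : - (f + q) = - f + (- q)); last by ring.
rewrite (_ : f + q - g + t = f - g + t + q); last by ring.
rewrite (fac_lower _ q) !mulmxA -{1}[q]opprK fac_refactor; last by rewrite mulrN qE; ring.
by congr (fac _ _ *m fac _ _ *m fac _ _ *m _); ring.
Qed.

(** No parameters are exchanged: pi merely rotates the three factors by one place. *)
Lemma trI_pi (f g a1 a2 t : R) :
  trI p (- g) (f - g + t) a2 (1 - a1 - a2) t = trT p f g a1 a2 t (- a2).
Proof.
rewrite trI_trT; symmetry.
apply: (trace_mono_swap (U := fun i => fac g (- a2 + i%:R + a2) *m fac (- f) (- a2 + i%:R))
          (V := fun i => fac (f - g + t) (- a2 + i%:R - a1))) => //.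
  move=> i; rewrite mulmxA -natr1; congr (fac _ _ *m fac _ _ *m fac _ _); ring.
by rewrite pcharf0.
Qed.

End Char.

(** * Traces as sums over closed words, and sums over orbits *)

Lemma big_tuple_cons (V : nmodType) (I : finType) n (F : seq I -> V) :
  \sum_(t : n.+1.-tuple I) F t = \sum_(c : I) \sum_(t : n.-tuple I) F (c :: t).
Proof.
rewrite pair_big /= (reindex (fun ct : I * n.-tuple I => cons_tuple ct.1 ct.2)) //=.
exists (fun t : n.+1.-tuple I => (thead t, [tuple of behead t])) => [[c t]|t] _ /=.
  by rewrite theadE; congr (_, _); apply: val_inj.
by rewrite [RHS]tuple_eta; apply: val_inj.
Qed.

Section ClosedWords.
Variable R : comNzRingType.

(** The tuple lists the indices between column b and row a. The default of [nth] matters: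
    [nth a t n] lies past the end and yields a. *)
Lemma mono_words n (X : nat -> 'M[R]_2) a b :
  mono n.+1 X a b = \sum_(t : n.-tuple 'I_2)
    \prod_(i < n.+1) X i (nth a t i) (nth a (b :: t) i).
Proof.
elim: n X b => [|n IH] X b.
  rewrite (big_pred1 [tuple]) => [|t]; last by rewrite [t]tuple0; apply/esym/eqP.

  by rewrite monoS mono0 mulmx1 big_ord_recl big_ord0 mulr1.
rewrite monoSr mxE (big_tuple_cons _ (fun t => \prod_(i < n.+2) X i (nth a t i) (nth a (b :: t) i))).
apply: eq_bigr => c _; rewrite IH mulr_suml; apply: eq_bigr => t _.
by rewrite mulrC [RHS]big_ord_recl.
Qed.

(** Taking a = b closes the path, and [ordS] wraps the last position to 0. Finite functions replace
    tuples so that rotation acts by reindexing. *)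
Lemma trace_mono_words n (X : nat -> 'M[R]_2) :
  \tr (mono n.+1 X) =
  \sum_(v : {ffun 'I_n.+1 -> 'I_2}) \prod_(i < n.+1) X i (v (ordS i)) (v i).
Proof.
pose F (s : seq 'I_2) :=
  \prod_(i < n.+1) X i (nth ord0 (rot 1 s) i) (nth ord0 s i).
transitivity (\sum_(t : n.+1.-tuple 'I_2) F t).
  rewrite big_tuple_cons; apply: eq_bigr => a _; rewrite mono_words.
  apply: eq_bigr => t _; apply: eq_bigr => i _.
  rewrite rot1_cons; congr (X i _ _).
    rewrite nth_rcons size_tuple; have := ltn_ord i; rewrite ltnS leq_eqVlt.
    case/orP => [/eqP->|lt_in]; last by rewrite lt_in; apply: set_nth_default; rewrite size_tuple.
    by rewrite ltnn eqxx nth_default // size_tuple.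
  by apply: set_nth_default; rewrite /= size_tuple.
rewrite (reindex (@tuple_of_finfun _ _)); last first.
  by exists (@finfun_of_tuple _ _) => t _; [exact: tuple_of_finfunK | exact: finfun_of_tupleK].
apply: eq_bigr => v _; apply: eq_bigr => i _.
have nthE (j : 'I_n.+1) : nth ord0 (tuple_of_finfun v) j = v j.
  by rewrite /= (nth_map j) ?size_enum_ord // nth_ord_enum.
congr (X i _ _); last exact: nthE.
rewrite /rot nth_cat size_drop size_tuple subn1 -nthE /=.
case: ltnP => [lt_in|ge_in]; first by rewrite nth_drop add1n modn_small.
have -> : i = n :> nat by apply/eqP; rewrite eqn_leq ge_in -ltnS ltn_ord.
by rewrite subnn modnn nth_take.
Qed.

End ClosedWords.

(** The order of s divides p, so orbits have 1 or p elements; an orbit of size p is run through once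
    by the powers j < p. *)
Lemma sum_fixed_points (V : zmodType) (T : finType) (s : {perm T}) (p : nat) (F : T -> V) :
    prime p -> (s ^+ p)%g = 1%g ->
    (forall x, s x != x -> \sum_(j < p) F ((s ^+ j)%g x) = 0) ->
  \sum_x F x = \sum_(x | s x == x) F x.
Proof.
move=> p_pr sp1 F0; rewrite (bigID (fun x => s x == x)) /= -[RHS]addr0; congr (_ + _).
rewrite (partition_big (porbit s) (mem (porbits s))) /=; last first.
  by move=> x _; exact: imset_f.
apply: big1 => _ /imsetP[x _ ->].
have fixP y : (s y == y) = (#|porbit s y| == 1)%N.
  apply/eqP/eqP => [sy | c1]; last by have := iter_porbit s y; rewrite c1.
  apply/eqP; rewrite eqn_leq lt0n card_porbit_neq0 andbT; apply/card_le1_eqP => u v.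
  have fix_iter k : (s ^+ k)%g y = y by rewrite permX; elim: k => //= k ->.
  by move=> /porbitP[i ->] /porbitP[j ->]; rewrite !fix_iter.
have fix_porbit y : porbit s y = porbit s x -> (s y == y) = (s x == x).
  by rewrite !fixP => ->.
have [sx | sx] := boolP (s x == x).
  by rewrite big_pred0 // => y; apply/negP => /andP[+ /eqP/fix_porbit]; rewrite sx => /negPf->.
have cardx : #|porbit s x| = p.
  have /primeP[_ p_div] := p_pr.
  have : (#|porbit s x| %| p)%N.
    apply: dvdn_trans (_ : #[s]%g %| p)%N; last by rewrite order_dvdn sp1.
    by rewrite porbitE; exact: dvdn_orbit.
  by move/p_div; rewrite -fixP (negPf sx) => /eqP.
transitivity (\sum_(y in porbit s x) F y).
  apply: eq_bigl => y; rewrite -eq_porbit_mem.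
  by apply: andb_idl => /eqP/fix_porbit->.
have memE := porbit_traject s x; rewrite cardx in memE.
have u := uniq_traject_porbit s x; rewrite cardx in u.
rewrite (eq_bigl (mem (traject s x p))) //= -big_uniq //=.
rewrite (big_nth x) size_traject big_mkord -[RHS](F0 x sx); apply: eq_bigr => j _.
by rewrite nth_traject // permX.
Qed.

Lemma val_iter_ordS n k (i : 'I_n) : iter k (@ordS n) i = ((i + k) %% n)%N :> nat.
Proof.
elim: k => [|k IH]; first by rewrite addn0 modn_small.
by rewrite iterS /= IH -addn1 modnDml addn1 addnS.
Qed.

(** * Power sums and products over the prime field *)

Section CharField.
Variables (K : fieldType) (p : nat).
Hypothesis charK : p \in [pchar K].

Let p_prime : prime p := pcharf_prime charK.
Let p_gt0 : (0 < p)%N := prime_gt0 p_prime.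
Let p_gt1 : (1 < p)%N := prime_gt1 p_prime.

Lemma natr_lt_pchar_neq0 m : (0 < m < p)%N -> m%:R != 0 :> K.
Proof. by case/andP=> m0 mp; rewrite -(dvdn_pcharf charK) gtnNdvd. Qed.

Lemma ordS_natr (i : 'I_p) : (ordS i)%:R = i%:R + 1 :> K.
Proof. by rewrite natr1 -(GRing.natr_mod_pchar charK i.+1). Qed.

Lemma exprD_pchar (x y : K) : (x + y) ^+ p = x ^+ p + y ^+ p.
Proof. exact: (rmorphD (pFrobenius_aut charK) x y). Qed.

Lemma exprN_pchar (x : K) : (- x) ^+ p = - x ^+ p.
Proof. exact: (rmorphN (pFrobenius_aut charK) x). Qed.

(** The sum of (j + 1)^(m+1) - j^(m+1) telescopes to 0. In its expansion the powers below m vanish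
    by induction, leaving m + 1 times the sum in question, and m + 1 < p is invertible. *)
Lemma sum_powers_eq0 m : (m < p.-1)%N -> \sum_(j < p) j%:R ^+ m = 0 :> K.
Proof.
elim/ltn_ind: m => m IH m_lt.
have tele : \sum_(j < p) ((j%:R + 1) ^+ m.+1 - j%:R ^+ m.+1) = 0 :> K.
  under eq_bigr do rewrite natr1.
  rewrite -(big_mkord xpredT (fun j => j.+1%:R ^+ m.+1 - j%:R ^+ m.+1 : K)).
  by rewrite (telescope_sumr (fun j => j%:R ^+ m.+1)) // pcharf0 // !expr0n subrr.
have : \sum_(j < p) ((j%:R + 1) ^+ m.+1 - j%:R ^+ m.+1) =
    (\sum_(j < p) j%:R ^+ m) * m.+1%:R :> K.
  transitivity (\sum_(i < m.+1) (\sum_(j < p) j%:R ^+ i) *+ 'C(m.+1, i) : K).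
    under [RHS]eq_bigr do rewrite -sumrMnl.
    rewrite exchange_big; apply: eq_bigr => j _ /=.
    rewrite (addrC _ 1) exprDn big_ord_recr /= subnn expr0 mul1r binn mulr1n addrK.
    by apply: eq_bigr => i _; rewrite expr1n mul1r.
  rewrite big_ord_recr /= big1 ?add0r => [|i _].
    by rewrite binSn mulr_natr.
  by rewrite IH ?mul0rn // (ltn_trans _ m_lt).
rewrite tele => /esym/eqP; rewrite mulf_eq0 (negPf (natr_lt_pchar_neq0 _)) ?orbF.
  by move/eqP.
by move: m_lt p_gt1; lia.
Qed.

Lemma uniq_residues : uniq [seq i%:R : K | i <- iota 0 p].
Proof.
rewrite map_inj_in_uniq ?iota_uniq // => i j; rewrite !mem_iota /= !add0n.
wlog le_ij : i j / (i <= j)%N => [wl ip jp eqij|ip jp eqij].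
  by case/orP: (leq_total i j) => le; [apply: wl | apply/esym/wl].
apply/eqP; rewrite eqn_leq le_ij /= -subn_eq0; apply/negPn/negP => ne0.
have /negP[] : (j - i)%:R != 0 :> K by apply: natr_lt_pchar_neq0; lia.
by rewrite natrB // eqij subrr.
Qed.

(* By Taylor's formula and the vanishing of the low power sums, the left-hand
   side is a polynomial in x of degree at most deg g - (p - 1) < p, and it takes
   the same value at the p points of the prime field. *)
Lemma sum_shifts_const (g : {poly K}) (x : K) : (size g <= (2 * p).-1)%N ->
  \sum_(j < p) g.[x + j%:R] = \sum_(j < p) g.[j%:R].
Proof.
move=> size_g.
pose S := \sum_(m < size g) (\sum_(j < p) j%:R ^+ m) *: g^`N(m).
have SE y : S.[y] = \sum_(j < p) g.[y + j%:R].
  under [RHS]eq_bigr do rewrite (nderiv_taylor _ (mulrC _ _)).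
  rewrite exchange_big horner_sum; apply: eq_bigr => m _.
  by rewrite hornerZ mulrC mulr_sumr.
have size_S : (size S <= p)%N.
  rewrite (leq_trans (size_sum _ _ _)) //; apply/bigmax_leqP => m _.
  have [m_lt | m_ge] := ltnP m p.-1.
    by rewrite sum_powers_eq0 // scale0r size_poly0.
  rewrite (leq_trans (size_scale_leq _ _)) //; apply/leq_sizeP => i le_pi.
  rewrite coef_nderivn nth_default ?mul0rn // (leq_trans size_g) //.
  by move: p_gt1 m_ge le_pi; clear; lia.
have S1 y : S.[y + 1] = S.[y].
  rewrite !SE; move: (pcharf0 charK).
  case: p p_gt0 => // q _ q0.
  rewrite big_ord_recr [RHS]big_ord_recl /= addrC addr0 -addrA nat1r q0 addr0.
  by congr (_ + _); apply: eq_bigr => i _; rewrite -addrA nat1r.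
have Snat k : S.[k%:R] = S.[0].
  by elim: k => // k IH; rewrite -natr1 S1.
suff SC : S = (S.[0])%:P.
  by rewrite -SE SC hornerC SE; apply: eq_bigr => j _; rewrite add0r.
apply/eqP; rewrite -subr_eq0; apply/eqP.
apply: (@roots_geq_poly_eq0 _ _ [seq i%:R | i <- iota 0 p]).
- by apply/allP => _ /mapP[k _ ->]; rewrite /root !hornerE Snat subrr.
- exact: uniq_residues.
- rewrite size_map size_iota (leq_trans (size_polyD _ _)) // geq_max size_S size_polyN.
  by rewrite (leq_trans (size_polyC_leq1 _)).
Qed.

(** X^p - X is monic of degree p and, by Fermat, vanishes at the p distinct points -i. *)
Lemma prod_shifts (x : K) : \prod_(i < p) (x + i%:R) = x ^+ p - x.
Proof.
pose q : {poly K} := 'X^p - 'X.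
have size_q : size q = p.+1.
  by rewrite size_polyDl ?size_polyXn // size_polyN size_polyX ltnS.
have root_q c : root q c = (c ^+ p == c).
  by rewrite /root !hornerE subr_eq0.
pose rs : seq K := [seq - i | i <- [seq i%:R | i <- iota 0 p]].
have := @all_roots_prod_XsubC _ q rs.
rewrite !size_map size_iota => /(_ size_q) q_fact.
have {q_fact} : q = lead_coef q *: \prod_(z <- rs) ('X - z%:P).
  apply: q_fact.
    apply/allP => _ /mapP[_ /mapP[k _ ->] ->]; rewrite root_q exprN_pchar.
    by rewrite -(pFrobenius_autE charK) pFrobenius_aut_nat.
  by rewrite uniq_rootsE (map_inj_uniq oppr_inj) uniq_residues.
have -> : lead_coef q = 1.
  by rewrite lead_coefDl ?lead_coefXn // size_polyN size_polyX size_polyXn ltnS.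
move/(congr1 (horner^~ x)); rewrite scale1r !hornerE => ->.
rewrite horner_prod !big_map (_ : iota 0 p = index_iota 0 p) ?big_mkord; last by rewrite /index_iota subn0.
by apply: eq_bigr => i _; rewrite !hornerE opprK.
Qed.

(** For nonzero a, pull out a and apply [prod_shifts] at x + b/a and at b/a; since Frobenius is
    additive, b/a drops out of the difference. *)
Lemma prod_affine_shifts (a b x : K) :
  \prod_(i < p) (a * (x + i%:R) + b) - \prod_(i < p) (a * i%:R + b) = a ^+ p * (x ^+ p - x).
Proof.
have [-> | a0] := eqVneq a 0.
  rewrite expr0n gtn_eqF // mul0r; apply/eqP; rewrite subr_eq0; apply/eqP.
  by apply: eq_bigr => i _; rewrite !mul0r.
have fact y : \prod_(i < p) (a * (y + i%:R) + b) = a ^+ p * ((y + b / a) ^+ p - (y + b / a)).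
  have -> : a ^+ p = \prod_(i < p) a by rewrite prodr_const card_ord.
  rewrite -prod_shifts -big_split /=.
  by apply: eq_bigr => i _; field.
have := fact 0; under eq_bigr do rewrite add0r; move=> ->.
by rewrite fact -mulrBr !exprD_pchar expr0n gtn_eqF //=; ring.
Qed.

End CharField.

(** * Rotation of cyclic words *)

Section Rotation.
Variables (n : nat) (T : finType).

Definition rotate (v : {ffun 'I_n -> T}) : {ffun 'I_n -> T} := [ffun i => v (ord_pred i)].

Lemma rotate_inj : injective rotate.
Proof.
move=> u v /ffunP uv; apply/ffunP => i.
by have := uv (ordS i); rewrite !ffunE ordSK.
Qed.

Definition rot_perm : {perm {ffun 'I_n -> T}} := perm rotate_inj.

Lemma rot_permX k v i : (rot_perm ^+ k)%g v (iter k (@ordS n) i) = v i.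
Proof.
rewrite permX; elim: k => [//|k IH]; rewrite !iterS permE ffunE ordSK; exact: IH.
Qed.

Lemma rot_perm_order : (rot_perm ^+ n)%g = 1%g.
Proof.
apply/permP => v; apply/ffunP => i; rewrite perm1 -[RHS](rot_permX n).
by congr (_ _); apply: val_inj; rewrite /= val_iter_ordS modnDr modn_small.
Qed.

End Rotation.

(** A fixed word is constant, since i applications of [ordS] lead from [ord0] to i. *)
Lemma sum_rot_perm_fixed (V : zmodType) (n : nat) (T : finType) (F : {ffun 'I_n.+1 -> T} -> V) :
  \sum_(v | rot_perm n.+1 T v == v) F v = \sum_(c : T) F [ffun=> c].
Proof.
rewrite (reindex (fun c : T => [ffun=> c])) /=.
  by apply: eq_bigl => c; apply/eqP/ffunP => i; rewrite permE !ffunE.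
exists (fun v => v ord0) => [c _ | v]; first by rewrite ffunE.
rewrite inE => /eqP fix_v; apply/ffunP => i; rewrite ffunE.
have fix_vk k : (rot_perm n.+1 T ^+ k)%g v = v by rewrite permX; elim: k => //= k ->.
rewrite -{1}(rot_permX i v ord0) fix_vk; congr (v _); apply: val_inj.
by rewrite /= val_iter_ordS add0n modn_small.
Qed.

(** * Dependence of T(z) on z *)

Section TraceShift.
Variables (K : fieldType) (p : nat).
Hypothesis charK : p \in [pchar K].
Variables f g a1 a2 t : K.

(** The entries of [lax3] as polynomials in z, for counting degrees; only the lower left one is
    quadratic. *)
Definition entry (a b : 'I_2) : {poly K} :=
  if a == 0 then
    if b == 0 then (f + t)%:P * 'X - (f * g * (f - g + t) + g * a1)%:P else 'X - (f * g)%:P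
  else
    if b == 0 then ('X + a2%:P) * ('X - (a1 + f * (f - g + t))%:P) else - f%:P * ('X + a2%:P).

Lemma lax3_entry z a b : lax3 f g a1 a2 t z a b = (entry a b).[z].
Proof.
rewrite /lax3 !mul_mat22 mxE /entry; case: a => [[|[|//]]] ?; case: b => [[|[|//]]] ? /=.
all: by rewrite !hornerE; ring.
Qed.

Lemma size_entry a b : (size (entry a b) <= 2 + ((a == 1%R) && (b == 0%R)))%N.
Proof.
have sX c : (size ('X + c%:P : {poly K})%R <= 2)%N by rewrite size_XaddC.
have sXB c : (size ('X - c%:P : {poly K})%R <= 2)%N by rewrite size_XsubC.
have sC c : (size (c%:P : {poly K}) <= 1)%N by exact: size_polyC_leq1.
have sM (q r : {poly K}) m k : (size q <= m)%N -> (size r <= k)%N -> (size (q * r)%R <= (m + k).-1)%N.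
  by move=> qm rk; apply: leq_trans (size_polyMleq _ _) _; lia.
rewrite /entry; case: a => [[|[|//]]] ?; case: b => [[|[|//]]] ? /=.
- rewrite (leq_trans (size_polyD _ _)) // geq_max size_polyN (leq_trans (sC _)) // andbT.
  by apply: (sM _ _ 1%N 2%N); rewrite ?size_polyX.
- exact: sXB.
- exact: (sM _ _ 2%N 2%N).
- by rewrite mulNr size_polyN; exact: (sM _ _ 1%N 2%N).
Qed.

Definition word_poly (v : {ffun 'I_p -> 'I_2}) : {poly K} :=
  \prod_(i < p) (entry (v (ordS i)) (v i) \Po ('X + i%:R%:P)).

Lemma horner_word_poly v x :
  (word_poly v).[x] = \prod_(i < p) (entry (v (ordS i)) (v i)).[x + i%:R].
Proof. by rewrite horner_prod; apply: eq_bigr => i _; rewrite horner_comp !hornerE. Qed.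

Lemma trT_words z : trT p f g a1 a2 t z = \sum_v (word_poly v).[z].
Proof.
have := prime_gt0 (pcharf_prime charK); rewrite /word_poly /trT.
move: horner_word_poly; rewrite /word_poly.
case: p => // n hw _; rewrite trace_mono_words; apply: eq_bigr => v _; rewrite hw.
by apply: eq_bigr => i _; rewrite lax3_entry.
Qed.

(** Reindexing by [ordS] turns one rotation into z := z + 1; the wrap from p - 1 to 0 is consistent
    because p = 0 in K. *)
Lemma word_poly_rot v k x :
  (word_poly ((rot_perm p _ ^+ k)%g v)).[x] = (word_poly v).[x + k%:R].
Proof.
elim: k v x => [|k IH] v x; first by rewrite expg0 perm1 addr0.
rewrite expgSr permM -natr1 addrA -addrAC.
rewrite -IH !horner_word_poly [LHS](reindex _ (onW_bij _ (ordS_bij p))) /=.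
apply: eq_bigr => i _; rewrite !permE !ffunE !ordSK (ordS_natr charK).
by congr (_.[_]); ring.
Qed.

(* Only the entries at an ascent of v (a 0 cyclically followed by a 1) are
   quadratic; ascents are pairwise disjoint, so at most p/2 <= p - 2 of them. *)
Lemma size_word_poly v : (2 < p)%N -> (size (word_poly v) <= (2 * p).-1)%N.
Proof.
move=> p_gt2; apply: leq_trans (size_poly_prod_leq _ _) _.
rewrite (eq_card (B := 'I_p)) // card_ord.
pose asc i := ((v (ordS i) == 1) && (v i == 0) : nat).
have le_size : (\sum_(i < p) size (entry (v (ordS i)) (v i) \Po ('X + i%:R%:P)) <= 2 * p + \sum_(i < p) asc i)%N.
  have -> : (2 * p = \sum_(i < p) 2)%N by rewrite sum_nat_const card_ord mulnC.
  rewrite -big_split leq_sum // => i _.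
  by rewrite size_comp_poly2 ?size_XaddC // size_entry.
have le_asc : (2 * (\sum_(i < p) asc i) <= p)%N.
  have ones : (\sum_(i < p) asc i <= \sum_(i < p) (v i == 1%R))%N.
    rewrite [leqRHS](reindex _ (onW_bij _ (ordS_bij p))) leq_sum // => i _.
    by rewrite /asc /=; case: (v (ordS i) == 1); case: (v i == 0).
  have zeros : (\sum_(i < p) asc i <= \sum_(i < p) (v i == 0%R))%N.
    by rewrite leq_sum // => i _; rewrite /asc /=; case: (v (ordS i) == 1); case: (v i == 0).
  have : (\sum_(i < p) (v i == 1%R) + \sum_(i < p) (v i == 0%R) <= \sum_(i < p) 1)%N.
    rewrite -big_split leq_sum // => i _ /=.
    by case: (v i) => [[|[|//]]] ?.
  rewrite sum1_card card_ord; lia.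
apply: leq_trans (leq_sub2r p (le_size : (_.+1 <= _.+1)%N)) _.
move: (\sum_(i < p) asc i)%N le_asc p_gt2; clear; lia.
Qed.

Lemma trT_shift z : (2 < p)%N ->
  trT p f g a1 a2 t z - trT p f g a1 a2 t 0 = t ^+ p * (z ^+ p - z).
Proof.
move=> p_gt2; rewrite !trT_words -sumrB.
(* The difference T(z) - T(0) is summed as a whole, so each orbit of nonconstant words contributes
   0. *)
rewrite (sum_fixed_points (s := rot_perm p _) (pcharf_prime charK) (rot_perm_order _ _)); last first.
  move=> v _; rewrite sumrB; apply/eqP; rewrite subr_eq0; apply/eqP.
  under eq_bigr do rewrite word_poly_rot.
  under [RHS]eq_bigr do rewrite word_poly_rot add0r.
  by rewrite sum_shifts_const // size_word_poly.
transitivity (\sum_(c : 'I_2) ((word_poly [ffun=> c]).[z] - (word_poly [ffun=> c]).[0])).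
  have := prime_gt0 (pcharf_prime charK); rewrite /word_poly.
  by case: p => // n _; rewrite sum_rot_perm_fixed.
rewrite !big_ord_recl big_ord0 addr0 !horner_word_poly.
have diag c a b : (forall y, (entry c c).[y] = a * y + b) ->
    \prod_(i < p) (entry ([ffun=> c] (ordS i)) ([ffun=> c] i)).[z + i%:R] -
    \prod_(i < p) (entry ([ffun=> c] (ordS i)) ([ffun=> c] i)).[0 + i%:R] =
    a ^+ p * (z ^+ p - z).
  move=> ent; rewrite -(prod_affine_shifts charK a b).
  by congr (_ - _); apply: eq_bigr => i _; rewrite !ffunE ent ?add0r.
rewrite (diag _ (f + t) (- (f * g * (f - g + t) + g * a1))); last first.
  by move=> y; rewrite /entry /= !hornerE.
rewrite (diag _ (- f) (- (f * a2))); last first.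
  by move=> y; rewrite /entry /= !hornerE; ring.
by rewrite exprN_pchar ?exprD_pchar //; ring.
Qed.

(** The degree bound fails here: a word of length 2 may have an ascent, while p - 2 = 0. Both traces
    are expanded instead. *)
Lemma trT_shift2 z : p = 2%N ->
  trT p f g a1 a2 t z - trT p f g a1 a2 t 0 = (1 + t ^+ 2) * (z ^+ 2 + z).
Proof.
move=> p2; have two0 : 1 + 1 = 0 :> K by rewrite -(pcharf0 charK) p2.
rewrite p2 /trT !monoS !mono0 !mulmx1 /lax3 !mul_mat22 !mxtrace_mat22 /=.
(* The entries of [lax3] are Az + B, z + C, z^2 + sz + a2 E and -f(z + a2). Over the integers, T(z)
   - T(0) exceeds the claimed value by 2Q. *)
pose A := f + t; pose B := - (f * g * (f - g + t) + g * a1); pose C := - (f * g).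
pose E := - (a1 + f * (f - g + t)); pose s := a2 + E.
pose Q := (f * t + f ^+ 2) * (z ^+ 2 + z) + (A * B + f ^+ 2 * a2) * z +
  z ^+ 3 + (s + C + 1) * z ^+ 2 + (a2 * E + s + s * C + C) * z.
transitivity ((1 + t ^+ 2) * (z ^+ 2 + z) + (1 + 1) * Q); last by rewrite two0 mul0r addr0.
by rewrite /Q /s /E /C /B /A; ring.
Qed.
End TraceShift.

(** * Invariance of the corrected trace under each generator *)

Definition itilde (R : comNzRingType) (p : nat) (c f g a1 a2 t : R) : R :=
  if p == 2 then
    trI p f g a1 a2 t + (1 + t ^+ 2) * (a1 ^+ 2 + a1 + a2 ^+ 2 + a2)
  else
    trI p f g a1 a2 t + c * t ^+ p * (a1 ^+ p - a1 - a2 ^+ p + a2).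

Section Morphism.
Variables (R S : comNzRingType) (phi : {rmorphism R -> S}).

Lemma map_mat22 a b c d : map_mx phi (mat22 a b c d) = mat22 (phi a) (phi b) (phi c) (phi d).
Proof. by apply/matrixP => i j; rewrite !mxE; case: ifP => _; case: ifP. Qed.

Lemma rmorph_trI p f g a1 a2 t :
  phi (trI p f g a1 a2 t) = trI p (phi f) (phi g) (phi a1) (phi a2) (phi t).
Proof.
rewrite /trI -trace_map_mx rmorph_prod /=; congr (\tr _); apply: eq_bigr => i _.
by rewrite /lax !map_mxM !map_mat22 !(rmorph0, rmorph1, rmorphD, rmorphN, rmorphM, rmorph_nat).
Qed.

(** Passing 1/3 as the argument [c] allows it to be a constant polynomial, which morphisms then
    map. *)
Lemma rmorph_itilde p c f g a1 a2 t :
  phi (itilde p c f g a1 a2 t) = itilde p (phi c) (phi f) (phi g) (phi a1) (phi a2) (phi t).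
Proof.
by rewrite /itilde; case: ifP => _;
  rewrite !(rmorph1, rmorphD, rmorphN, rmorphM, rmorphXn, rmorph_trI).
Qed.

End Morphism.

Section Invariance.
Variables (K : fieldType) (p : nat).
Hypotheses (charK : p \in [pchar K]) (p_neq3 : p != 3).
Variables f g a1 a2 t q : K.

Let third_spec : 3 * 3%:R^-1 = 1 :> K.
Proof.
by rewrite mulfV // -(dvdn_pcharf charK) dvdn_prime2 ?(pcharf_prime charK).
Qed.

(** Once a generator sends T(0) to T(z), the shift formula reduces invariance to an identity in the
    parameters. For p = 2 it need only hold modulo 2; an explicit Q makes it an integral
    identity. *)
Lemma eq_itilde a1' a2' f' g' z :
    trI p f' g' a1' a2' t = trT p f g a1 a2 t z ->
    (p = 2 -> exists Q, z ^+ 2 + z + (a1' ^+ 2 + a1' + a2' ^+ 2 + a2') =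
        a1 ^+ 2 + a1 + a2 ^+ 2 + a2 + 2 * Q) ->
    3 * (z ^+ p - z) + (a1' ^+ p - a1' - a2' ^+ p + a2') = a1 ^+ p - a1 - a2 ^+ p + a2 ->
  itilde p 3%:R^-1 f' g' a1' a2' t = itilde p 3%:R^-1 f g a1 a2 t.
Proof.
rewrite /itilde => -> even odd; rewrite (trI_trT charK).
case: eqP => [p2 | pn2].
  have [Q QE] := even p2; have two0 : 2 = 0 :> K by rewrite -(pcharf0 charK) p2.
  apply: (@addIr _ (- trT p f g a1 a2 t 0)).
  rewrite addrAC trT_shift2 // -mulrDr QE two0 mul0r addr0; ring.
have p_gt2 : (2 < p)%N by have := prime_gt1 (pcharf_prime charK); lia.
apply: (@addIr _ (- trT p f g a1 a2 t 0)); rewrite addrAC trT_shift // -odd.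
transitivity (3 * 3%:R^-1 * (t ^+ p * (z ^+ p - z)) + 3^-1 * t ^+ p * (a1' ^+ p - a1' - a2' ^+ p + a2')).
  by rewrite third_spec mul1r.
by ring.
Qed.

Let powE := (exprD_pchar charK, exprN_pchar charK, expr1n).

Lemma itilde_s0 : (f - g + t) * q = a1 + a2 - 1 ->
  itilde p 3%:R^-1 (f + q) (g + q) (1 - a2) (1 - a1) t = itilde p 3%:R^-1 f g a1 a2 t.
Proof.
move=> qE; apply: (@eq_itilde _ _ _ _ 0).
- by rewrite trI_s0 // trI_trT.
- by move=> _; exists (2 - 2 * a1 - 2 * a2); ring.
- by rewrite !powE expr0n gtn_eqF ?prime_gt0 ?(pcharf_prime charK) //=; ring.
Qed.

Lemma itilde_s1 : f * q = a1 ->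
  itilde p 3%:R^-1 f (g - q) (- a1) (a1 + a2) t = itilde p 3%:R^-1 f g a1 a2 t.
Proof.
move=> qE; apply: (@eq_itilde _ _ _ _ a1).
- by rewrite trI_s1.
- by move=> _; exists (a1 ^+ 2 + a1 * a2); ring.
- by rewrite !powE; ring.
Qed.

Lemma itilde_s2 : g * q = a2 ->
  itilde p 3%:R^-1 (f + q) g (a1 + a2) (- a2) t = itilde p 3%:R^-1 f g a1 a2 t.
Proof.
move=> qE; apply: (@eq_itilde _ _ _ _ (- a2)).
- by rewrite trI_s2.
- by move=> _; exists (a2 ^+ 2 + a1 * a2 - a2); ring.
- by rewrite !powE; ring.
Qed.

Lemma itilde_pi :
  itilde p 3%:R^-1 (- g) (f - g + t) a2 (1 - a1 - a2) t = itilde p 3%:R^-1 f g a1 a2 t.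
Proof.
apply: (@eq_itilde _ _ _ _ (- a2)).
- by rewrite trI_pi.
- by move=> _; exists (a2 ^+ 2 + a1 * a2 - 2 * a1 - 2 * a2 + 1); ring.
- by rewrite !powE; ring.
Qed.

End Invariance.

(** * Substitutions on the field of rational functions *)

Section Substitution.
Variable F : fieldType.
Local Notation P := (PolR F).
Local Notation K := (RatF F).
Local Notation "x %:F" := (tofrac (x : P)).

Definition const_frac : {rmorphism F -> K} := (@tofrac P) \o (@mpolyC 5 F).

Definition subst_mor (img : 'I_5 -> K) : {rmorphism P -> K} := mmap const_frac img.

Lemma subst_morE img (q : P) : subst_pol img q = subst_mor img q.
Proof. by []. Qed.

Lemma subst_morX img i : subst_mor img 'X_i = img i.
Proof. by rewrite /subst_mor /= mmapX mmap1U. Qed.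

Lemma subst_morC img c : subst_mor img c%:MP = const_frac c.
Proof. exact: mmapC. Qed.

Lemma frac_repr_tofrac (q : P) : (frac (repr q%:F)).1 = q * (frac (repr q%:F)).2.
Proof.
have := FracField.equivf_r (Ratio q 1); rewrite !numden_Ratio ?oner_neq0 // mul1r.
by rewrite /FracField.tofrac; unlock=> ->.
Qed.

(** [subst] sees an unspecified representative qd/d of q; cancelling d requires its image to be
    nonzero, whence the injectivity lemmas below. *)
Lemma subst_tofrac img (q : P) :
  (forall d : P, d != 0 -> subst_mor img d != 0) -> subst img q%:F = subst_mor img q.
Proof.
move=> inj; rewrite /subst frac_repr_tofrac !subst_morE rmorphM mulfK //.
exact: inj (denom_ratioP _).
Qed.

(* img' inverts img up to powers of D, a common denominator of the images. *)
Lemma subst_mor_neq0 (img img' : 'I_5 -> K) (D : P) :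
    subst_mor img' D != 0 ->
    (forall i, exists2 N : P, N%:F = D%:F * img i &
        subst_mor img' N = subst_mor img' D * ('X_i)%:F) ->
  forall q : P, q != 0 -> subst_mor img q != 0.
Proof.
move=> D0 invX.
(* D^k clears the denominators of the image of q, and img' recovers q from the result. Such q form a
   subring containing constants and variables, hence are all of P; if q has image 0, then N = 0 and
   so q = 0. *)
pose good (q : P) := exists k, exists2 N : P, N%:F = D%:F ^+ k * subst_mor img q &
  subst_mor img' N = subst_mor img' D ^+ k * q%:F.
have goodM : forall q r, good q -> good r -> good (q * r).
  move=> q r [k [N Nq Nq']] [l [M Mr Mr']]; exists (k + l)%N, (N * M).
    by rewrite tofracM Nq Mr rmorphM exprD mulrACA.
  by rewrite rmorphM Nq' Mr' tofracM exprD mulrACA.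
have goodD q r : good q -> good r -> good (q + r).
  move=> [k [N Nq Nq']] [l [M Mr Mr']]; exists (k + l)%N, (N * D ^+ l + M * D ^+ k).
    by rewrite tofracD !tofracM !tofracXn Nq Mr rmorphD exprD; ring.
  by rewrite rmorphD !rmorphM !rmorphXn Nq' Mr' tofracD exprD; ring.
have goodC c : good c%:MP.
  by exists 0%N, c%:MP; rewrite expr0 mul1r subst_morC.
have goodX i : good 'X_i.
  by have [N NX NX'] := invX i; exists 1%N, N; rewrite expr1 // subst_morX.
have good_all q : good q.
  elim/mpolyind: q => [|c m q _ _ IH]; first by rewrite -mpolyC0.
  apply: goodD => //; rewrite -mul_mpolyC; apply: (goodM) => //.
  rewrite mpolyXE_id; apply: (big_ind good) => [|//|i _]; first by rewrite -mpolyC1.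
  by elim: (m i) => [|k IHk]; rewrite ?expr0 ?exprS -?mpolyC1 //; apply: goodM.
move=> q q0; have [k [N Nq Nq']] := good_all q; apply/eqP => q_img0.
move: Nq; rewrite q_img0 mulr0 => /eqP; rewrite tofrac_eq0 => /eqP N0.
move: Nq'; rewrite N0 rmorph0 => /esym/eqP; rewrite mulf_eq0 expf_eq0 (negPf D0) andbF.
by rewrite tofrac_eq0 (negPf q0).
Qed.

Let o0 : 'I_5 := @Ordinal 5 0 isT.
Let o1 : 'I_5 := @Ordinal 5 1 isT.
Let o2 : 'I_5 := @Ordinal 5 2 isT.
Let o3 : 'I_5 := @Ordinal 5 3 isT.
Let o4 : 'I_5 := @Ordinal 5 4 isT.

Lemma Itilde_itilde p : Itilde F p = itilde p 3%:R^-1 (vf F) (vg F) (va1 F) (va2 F) (vt F).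
Proof. by []. Qed.

(** [Itilde] comes from a polynomial, with 1/3 among the constants, so [subst] acts on it as a ring
    morphism. *)
Lemma subst_Itilde p img : (forall d : P, d != 0 -> subst_mor img d != 0) ->
  subst img (Itilde F p) = itilde p 3%:R^-1 (img o0) (img o1) (img o2) (img o3) (img o4).
Proof.
move=> inj.
have third : const_frac 3%:R^-1 = 3%:R^-1 by rewrite fmorphV rmorph_nat.
have -> : Itilde F p = (itilde p (3%:R^-1)%:MP 'X_o0 'X_o1 'X_o2 'X_o3 'X_o4)%:F.
  by rewrite (rmorph_itilde (@tofrac P)) Itilde_itilde -third.
by rewrite subst_tofrac // rmorph_itilde !subst_morX subst_morC third.
Qed.

Lemma ord5_ind (Q : 'I_5 -> Prop) : Q o0 -> Q o1 -> Q o2 -> Q o3 -> Q o4 -> forall i, Q i.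
Proof.
move=> Q0 Q1 Q2 Q3 Q4 [[|[|[|[|[|//]]]]] lt_i5].
- by rewrite (val_inj (_ : val (Ordinal lt_i5) = val o0)).
- by rewrite (val_inj (_ : val (Ordinal lt_i5) = val o1)).
- by rewrite (val_inj (_ : val (Ordinal lt_i5) = val o2)).
- by rewrite (val_inj (_ : val (Ordinal lt_i5) = val o3)).
- by rewrite (val_inj (_ : val (Ordinal lt_i5) = val o4)).
Qed.

Let morE := (rmorphD, rmorphN, rmorphM, rmorph1, subst_morX).

Lemma polynomial_neq0 (img : 'I_5 -> K) (q : P) : subst_mor img q = 1 -> q%:F != 0.
Proof.
by move=> q1; rewrite tofrac_eq0; apply/eqP => q0; move/eqP: q1; rewrite q0 rmorph0 eq_sym oner_eq0.
Qed.

Lemma vf_neq0 : vf F != 0.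
Proof. by apply: (@polynomial_neq0 (fun=> 1)); rewrite subst_morX. Qed.

Lemma vg_neq0 : vg F != 0.
Proof. by apply: (@polynomial_neq0 (fun=> 1)); rewrite subst_morX. Qed.

Lemma f0_neq0 : vf F - vg F + vt F != 0.
Proof.
rewrite /vf /vg /vt /var -tofracB -tofracD.
by apply: (@polynomial_neq0 (fun=> 1)); rewrite !morE subrr add0r.
Qed.

Let varE : (('X_o0 : P)%:F = vf F) * (('X_o1 : P)%:F = vg F) * (('X_o2 : P)%:F = va1 F) *
  (('X_o3 : P)%:F = va2 F) * (('X_o4 : P)%:F = vt F).
Proof. by []. Qed.

Let tofracE := (tofracB, tofracD, tofracN, tofracM, tofrac1, varE).

(** s0 is an involution fixing the denominator f - g + t, so it serves as its own inverse; likewise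
    s1 with f and s2 with g. *)
Lemma img_s0_neq0 (q : P) : q != 0 -> subst_mor (@img_s0 F) q != 0.
Proof.
have DrE : (vf F - vg F + vt F) * ((va1 F + va2 F - 1) / (vf F - vg F + vt F)) =
    va1 F + va2 F - 1.
  by rewrite mulrC divfK // f0_neq0.
rewrite /img_s0; move: (_ / _) DrE => r DrE.
set img := img_of _ _ _ _ _.
have [D DF DE] : exists2 D : P, D%:F = vf F - vg F + vt F & subst_mor img D = vf F - vg F + vt F.
  exists ('X_o0 - 'X_o1 + 'X_o4); first by rewrite !tofracE.
  by rewrite !morE /img /img_of /=; ring.
apply: (@subst_mor_neq0 _ img D); rewrite ?DE ?DF ?f0_neq0 //.
apply: ord5_ind.
- exists (D * 'X_o0 + 'X_o2 + 'X_o3 - 1); rewrite ?tofracE ?DF ?morE ?DE /img /img_of /=.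
    by rewrite mulrDr DrE !addrA.
  by rewrite mulrDr DrE; ring.
- exists (D * 'X_o1 + 'X_o2 + 'X_o3 - 1); rewrite ?tofracE ?DF ?morE ?DE /img /img_of /=.
    by rewrite mulrDr DrE !addrA.
  by rewrite mulrDr DrE; ring.
- by exists (D * (1 - 'X_o3)); rewrite ?tofracE ?DF ?morE ?DE // /img /img_of /=; ring.
- by exists (D * (1 - 'X_o2)); rewrite ?tofracE ?DF ?morE ?DE // /img /img_of /=; ring.
- by exists (D * 'X_o4); rewrite ?tofracE ?DF ?morE ?DE.
Qed.

Lemma img_s1_neq0 (q : P) : q != 0 -> subst_mor (@img_s1 F) q != 0.
Proof.
have fqE : vf F * (va1 F / vf F) = va1 F by rewrite mulrC divfK // vf_neq0.
apply: (@subst_mor_neq0 _ (@img_s1 F) 'X_o0); first by rewrite !morE vf_neq0.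
apply: ord5_ind.
- by exists ('X_o0 * 'X_o0); rewrite ?tofracE ?morE.
- by exists ('X_o0 * 'X_o1 - 'X_o2); rewrite ?tofracE ?morE /img_s1 /img_of /= mulrBr fqE; ring.
- by exists (- 'X_o0 * 'X_o2); rewrite ?tofracE ?morE /img_s1 /img_of /=; ring.
- by exists ('X_o0 * ('X_o2 + 'X_o3)); rewrite ?tofracE ?morE /img_s1 /img_of /=; ring.
- by exists ('X_o0 * 'X_o4); rewrite ?tofracE ?morE.
Qed.

Lemma img_s2_neq0 (q : P) : q != 0 -> subst_mor (@img_s2 F) q != 0.
Proof.
have gqE : vg F * (va2 F / vg F) = va2 F by rewrite mulrC divfK // vg_neq0.
apply: (@subst_mor_neq0 _ (@img_s2 F) 'X_o1); first by rewrite !morE vg_neq0.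
apply: ord5_ind.
- by exists ('X_o1 * 'X_o0 + 'X_o3); rewrite ?tofracE ?morE /img_s2 /img_of /= mulrDr gqE; ring.
- by exists ('X_o1 * 'X_o1); rewrite ?tofracE ?morE.
- by exists ('X_o1 * ('X_o2 + 'X_o3)); rewrite ?tofracE ?morE /img_s2 /img_of /=; ring.
- by exists (- 'X_o1 * 'X_o3); rewrite ?tofracE ?morE /img_s2 /img_of /=; ring.
- by exists ('X_o1 * 'X_o4); rewrite ?tofracE ?morE.
Qed.

Lemma img_pi_neq0 (q : P) : q != 0 -> subst_mor (@img_pi F) q != 0.
Proof.
(* The tuple gives the inverse of pi; the images under pi are polynomials, so D = 1. *)
apply: (@subst_mor_neq0 _ (img_of (vg F - vf F - vt F) (- vf F) (1 - va1 F - va2 F) (va1 F) (vt F)) 1).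
  by rewrite rmorph1 oner_neq0.
apply: ord5_ind.
- by exists (- 'X_o1); rewrite ?tofracE ?morE /img_pi /img_of /=; ring.
- by exists ('X_o0 - 'X_o1 + 'X_o4); rewrite ?tofracE ?morE /img_pi /img_of /=; ring.
- by exists 'X_o3; rewrite ?tofracE ?morE /img_pi /img_of /=; ring.
- by exists (1 - 'X_o2 - 'X_o3); rewrite ?tofracE ?morE /img_pi /img_of /=; ring.
- by exists 'X_o4; rewrite ?tofracE ?morE /img_pi /img_of /=; ring.
Qed.

End Substitution.

Theorem theorem2p3 (p : nat) (F : fieldType) :
  prime p -> p != 3%N -> p \in [pchar F] ->
  forall w : RatF F -> RatF F, in_Wext w -> w (Itilde F p) = Itilde F p.
Proof.
move=> _ p_neq3 charF.
have charK : p \in [pchar (RatF F)] by exact: rmorph_pchar (const_frac F) _ charF.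
move=> w; elim=> [//| | | | |u v _ IHu _ IHv|u v _ IHu uK _].
- rewrite subst_Itilde; last exact: img_s0_neq0.
  by apply: itilde_s0 => //; rewrite mulrC divfK // f0_neq0.
- rewrite subst_Itilde; last exact: img_s1_neq0.
  by apply: itilde_s1 => //; rewrite mulrC divfK // vf_neq0.
- rewrite subst_Itilde; last exact: img_s2_neq0.
  by apply: itilde_s2 => //; rewrite mulrC divfK // vg_neq0.
- rewrite subst_Itilde; last exact: img_pi_neq0.
  exact: itilde_pi.
- by rewrite /= IHv.
- by rewrite -{1}IHu uK.
Qed.
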